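(* Let $\Omega$ be a semigroup with unit $1$, $(L,\mu,p)$ a Hom-associative algebra, $(V,\mu_l,\mu_r,q)$ a bimodule over it, $\Phi$ a 2-cocycle of $L$ with coefficients in $V$, and $\mathcal{R}=\{R_\alpha:V\to L\}_{\alpha\in\Omega}$ a $\Phi$-twisted Rota-Baxter family operator. If $\mathcal{R}^t=\mathcal{R}+t\mathcal{R}^1$, with $\mathcal{R}^1=\{R^1_\alpha:V\to L\}_{\alpha\in\Omega}$ a family of linear maps, is an infinitesimal deformation of $\mathcal{R}$, then $\mathcal{R}^1$ is a 1-cocycle in the cochain complex of $\mathcal{R}$, that is, $\mathcal{R}^1\in C^1_R(V,L)$ and $\delta^1_R(\mathcal{R}^1)=0$.
   Context: Work over a field $\mathbb{K}$ of characteristic $0$. A Hom-associative algebra $(L,\mu,p)$ is a vector space $L$ with a linear map $p:L\to L$ and a bilinear product $\mu(x,y)=x\cdot y$ such that $p(x\cdot y)=p(x)\cdot p(y)$ and $p(x)\cdot(y\cdot z)=(x\cdot y)\cdot p(z)$. A bimodule $(V,\mu_l,\mu_r,q)$ over it is a vector space $V$ with a linear map $q:V\to V$ and bilinear maps $\mu_l:L\times V\to V$, $(x,u)\mapsto x\cdot_l u$, and $\mu_r:V\times L\to V$, $(u,x)\mapsto u\cdot_r x$, such that $q(x\cdot_l u)=p(x)\cdot_l q(u)$, $q(u\cdot_r x)=q(u)\cdot_r p(x)$, $q(u)\cdot_r(x\cdot y)=(u\cdot_r x)\cdot_r p(y)$, $p(x)\cdot_l(u\cdot_r y)=(x\cdot_l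 u)\cdot_r p(y)$, $p(x)\cdot_l(y\cdot_l u)=(x\cdot y)\cdot_l q(u)$. A 2-cocycle of $L$ with coefficients in $V$ is a bilinear map $\Phi:L\otimes L\to V$ with $q\,\Phi(x_1,x_2)=\Phi(p(x_1),p(x_2))$ and $p(x_1)\cdot_l\Phi(x_2,x_3)-\Phi(x_1,x_2)\cdot_r p(x_3)-\Phi(x_1\cdot x_2,p(x_3))+\Phi(p(x_1),x_2\cdot x_3)=0$. A $\Phi$-twisted Rota-Baxter family operator is a collection of linear maps $\{R_\alpha:V\to L\}_{\alpha\in\Omega}$ with $R_\alpha\circ q=p\circ R_\alpha$ and $R_\alpha u\cdot R_\beta v=R_{\alpha\beta}(R_\alpha u\cdot_l v+u\cdot_r R_\beta v+\Phi(R_\alpha u,R_\beta v))$ for all $u,v\in V$, $\alpha,\beta\in\Omega$. An infinitesimal deformation of $\mathcal{R}$ is a sum $\mathcal{R}^t=\mathcal{R}+t\mathcal{R}^1=\{R_\alpha+tR^1_\alpha\}_{\alpha\in\Omega}$ that is a $\Phi$-twisted Rota-Baxter family operator (on the same $V$, $L$, with the same $\Phi$) for all $t\in\mathbb{K}$. $C^1_R(V,L)$ is the space of families $f=\{f_\alpha\in\mathrm{Hom}(V,L)\}_{\alpha\in\Omega}$ with $p\circ f_\alpha=f_\alpha\circ q$ for all $\alpha$, and for such $f$ $$(\delta^1_R f)_{\alpha,\beta}(u,v)=R_\alpha u\cdot f_\beta(v)-R_{\alpha\beta}(u\cdot_r f_\beta(v))-R_{\alpha\beta}\Phi(R_\alpha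 u,f_\beta(v))-f_{\alpha\beta}\big(R_\alpha u\cdot_l v+u\cdot_r R_\beta v+\Phi(R_\alpha u,R_\beta v)\big)+f_\alpha(u)\cdot R_\beta v-R_{\alpha\beta}(f_\alpha(u)\cdot_l v)-R_{\alpha\beta}\Phi(f_\alpha(u),R_\beta v).$$ *)

(* Defs.v *)
From mathcomp Require Import all_boot all_algebra.

Set Implicit Arguments.
Unset Strict Implicit.
Unset Printing Implicit Defensive.

Import GRing.Theory.
Local Open Scope ring_scope.

Record hom_associative_algebra (K : fieldType) (L : lmodType K)
    (mu : {bilinear L -> L -> L}) (p : {linear L -> L}) : Prop := {
  hom_mult : forall x y : L, p (mu x y) = mu (p x) (p y);
  hom_assoc : forall x y z : L, mu (p x) (mu y z) = mu (mu x y) (p z)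
}.

Record hom_bimodule (K : fieldType) (L : lmodType K)
    (mu : {bilinear L -> L -> L}) (p : {linear L -> L}) (V : lmodType K)
    (mu_l : {bilinear L -> V -> V}) (mu_r : {bilinear V -> L -> V})
    (q : {linear V -> V}) : Prop := {
  hom_bimodule_l : forall (x : L) (u : V), q (mu_l x u) = mu_l (p x) (q u);
  hom_bimodule_r : forall (u : V) (x : L), q (mu_r u x) = mu_r (q u) (p x);
  hom_bimodule_rr : forall (u : V) (x y : L),
    mu_r (q u) (mu x y) = mu_r (mu_r u x) (p y);
  hom_bimodule_lr : forall (x : L) (u : V) (y : L),
    mu_l (p x) (mu_r u y) = mu_r (mu_l x u) (p y);
  hom_bimodule_ll : forall (x y : L) (u : V),
    mu_l (p x) (mu_l y u) = mu_l (mu x y) (q u)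
}.

Record two_cocycle (K : fieldType) (L : lmodType K)
    (mu : {bilinear L -> L -> L}) (p : {linear L -> L}) (V : lmodType K)
    (mu_l : {bilinear L -> V -> V}) (mu_r : {bilinear V -> L -> V})
    (q : {linear V -> V}) (Phi : {bilinear L -> L -> V}) : Prop := {
  two_cochain_comm : forall x1 x2 : L, q (Phi x1 x2) = Phi (p x1) (p x2);
  two_cocycle_closed : forall x1 x2 x3 : L,
    mu_l (p x1) (Phi x2 x3) - mu_r (Phi x1 x2) (p x3)
      - Phi (mu x1 x2) (p x3) + Phi (p x1) (mu x2 x3) = 0
}.

Record twisted_RB_family (K : fieldType) (Omega : monoidType) (L : lmodType K)
    (mu : {bilinear L -> L -> L}) (p : {linear L -> L}) (V : lmodType K)
    (mu_l : {bilinear L -> V -> V}) (mu_r : {bilinear V -> L -> V})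
    (q : {linear V -> V}) (Phi : {bilinear L -> L -> V})
    (R : Omega -> {linear V -> L}) : Prop := {
  twisted_RB_comm : forall (a : Omega) (u : V), R a (q u) = p (R a u);
  twisted_RB_eq : forall (a b : Omega) (u v : V),
    mu (R a u) (R b v) =
    R (a * b)%g (mu_l (R a u) v + mu_r u (R b v) + Phi (R a u) (R b v))
}.

Definition deform (K : fieldType) (Omega : monoidType) (L V : lmodType K)
    (R R1 : Omega -> {linear V -> L}) (t : K) : Omega -> {linear V -> L} :=
  fun a => R a \+ t \*: R1 a.

Definition infinitesimal_deformation (K : fieldType) (Omega : monoidType)
    (L : lmodType K) (mu : {bilinear L -> L -> L}) (p : {linear L -> L})
    (V : lmodType K) (mu_l : {bilinear L -> V -> V})
    (mu_r : {bilinear V -> L -> V}) (q : {linear V -> V})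
    (Phi : {bilinear L -> L -> V}) (R R1 : Omega -> {linear V -> L}) : Prop :=
  forall t : K, twisted_RB_family mu p mu_l mu_r q Phi (deform R R1 t).

Definition one_cochain (K : fieldType) (Omega : monoidType) (L : lmodType K)
    (p : {linear L -> L}) (V : lmodType K) (q : {linear V -> V})
    (f : Omega -> {linear V -> L}) : Prop :=
  forall (a : Omega) (u : V), p (f a u) = f a (q u).

Definition delta1 (K : fieldType) (Omega : monoidType) (L : lmodType K)
    (mu : {bilinear L -> L -> L}) (V : lmodType K)
    (mu_l : {bilinear L -> V -> V}) (mu_r : {bilinear V -> L -> V})
    (Phi : {bilinear L -> L -> V}) (R f : Omega -> {linear V -> L})
    (a b : Omega) (u v : V) : L :=
  mu (R a u) (f b v) - R (a * b)%g (mu_r u (f b v))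
  - R (a * b)%g (Phi (R a u) (f b v))
  - f (a * b)%g (mu_l (R a u) v + mu_r u (R b v) + Phi (R a u) (R b v))
  + mu (f a u) (R b v) - R (a * b)%g (mu_l (f a u) v)
  - R (a * b)%g (Phi (f a u) (R b v)).

Definition one_cocycle (K : fieldType) (Omega : monoidType) (L : lmodType K)
    (mu : {bilinear L -> L -> L}) (p : {linear L -> L}) (V : lmodType K)
    (mu_l : {bilinear L -> V -> V}) (mu_r : {bilinear V -> L -> V})
    (q : {linear V -> V}) (Phi : {bilinear L -> L -> V})
    (R f : Omega -> {linear V -> L}) : Prop :=
  one_cochain p q f /\
  (forall (a b : Omega) (u v : V), delta1 mu mu_l mu_r Phi R f a b u v = 0).

(* Main.v *)
(** Expanded in powers of [t], the twisted Rota-Baxter identity for [R + t R1]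
    is a polynomial identity of degree 3 in [t] with coefficients in [L], whose
    linear coefficient is [delta1 R1]. As [K] is infinite, inverting a
    Vandermonde matrix shows that every coefficient vanishes. *)

Require Import Defs.
From mathcomp Require Import all_boot all_algebra.

Import GRing.Theory.
Local Open Scope ring_scope.

(** The nodes [0, ..., n - 1] are distinct in characteristic 0, so column [i] of the inverse
    Vandermonde matrix gives weights that recover [c i] from the values of the polynomial at these
    nodes. *)
Lemma scaler_poly_coef_eq0 (K : fieldType) (V : lmodType K) (n : nat)
    (c : 'I_n -> V) :
  [pchar K] =i pred0 -> (forall t : K, \sum_(i < n) t ^+ i *: c i = 0) ->
  forall i, c i = 0.
Proof.
move=> /pcharf0P charK0 polyc0 i.
pose A : 'M[K]_n := Vandermonde n (\row_j j%:R).
have A_unit : A \in unitmx.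
  rewrite unitmxE det_Vandermonde unitfE; apply/prodf_neq0 => j _.
  apply/prodf_neq0 => k ltjk.
  by rewrite !mxE -natrB 1?ltnW // charK0 -lt0n subn_gt0.
have AVE k : \sum_j A k j * invmx A j i = (k == i)%:R.
  by have /matrixP/(_ k i) := mulmxV A_unit; rewrite !mxE.
have -> : c i = \sum_k (\sum_j A k j * invmx A j i) *: c k.
  rewrite (bigD1 i) //= AVE eqxx scale1r big1 ?addr0 // => k /negPf neq_ki.
  by rewrite AVE neq_ki scale0r.
under eq_bigr do rewrite scaler_suml.
rewrite exchange_big big1 //= => j _.
under eq_bigr do rewrite mulrC -scalerA !mxE.
by rewrite -scaler_sumr polyc0 scaler0.
Qed.

Lemma bilinear_affine (K : fieldType) (U V W : lmodType K)
    (f : {bilinear U -> V -> W}) (t : K) (x x1 : U) (y y1 : V) :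
  f (x + t *: x1) (y + t *: y1) =
  f x y + t *: (f x y1 + f x1 y) + t ^+ 2 *: f x1 y1.
Proof.
rewrite linearDl !linearDr !linearZl_LR !linearZr_LR /=.
by rewrite !scalerDr !scalerA -expr2 !addrA.
Qed.

Theorem mainTheorem13 (K : fieldType) (charK0 : [pchar K] =i pred0)
    (Omega : monoidType)
    (L : lmodType K) (mu : {bilinear L -> L -> L}) (p : {linear L -> L})
    (HL : hom_associative_algebra mu p)
    (V : lmodType K) (mu_l : {bilinear L -> V -> V})
    (mu_r : {bilinear V -> L -> V}) (q : {linear V -> V})
    (HV : hom_bimodule mu p mu_l mu_r q)
    (Phi : {bilinear L -> L -> V}) (HPhi : two_cocycle mu p mu_l mu_r q Phi)
    (R : Omega -> {linear V -> L}) (HR : twisted_RB_family mu p mu_l mu_r q Phi R)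
    (R1 : Omega -> {linear V -> L}) :
  infinitesimal_deformation mu p mu_l mu_r q Phi R R1 ->
  one_cocycle mu p mu_l mu_r q Phi R R1.
Proof.
move=> Rt_RB; split=> [a u|a b u v].
  (* At [t = 1], cancelling the commutation of [R] with [p] and [q] leaves that of [R1]. *)
  have := twisted_RB_comm (Rt_RB 1) a u.
  rewrite /deform /= !scale1r linearD (twisted_RB_comm HR).
  by move/addrI.
(* Coefficients of 1, [t] and [t ^+ 2] in the argument of the deformed operator at [a * b]. Only
   [Phi] takes two deformed arguments, so [W2] is a single term. *)
pose W0 := mu_l (R a u) v + mu_r u (R b v) + Phi (R a u) (R b v).
pose W1 := mu_l (R1 a u) v + mu_r u (R1 b v)
  + (Phi (R a u) (R1 b v) + Phi (R1 a u) (R b v)).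
pose W2 := Phi (R1 a u) (R1 b v).
pose S := R (a * b)%g; pose S1 := R1 (a * b)%g.
(* Left side minus right side of the identity, by powers of [t]; the cubic term comes from [S1]
   applied to [W2]. *)
pose c : seq L := [::
  mu (R a u) (R b v) - S W0;
  mu (R a u) (R1 b v) + mu (R1 a u) (R b v) - (S W1 + S1 W0);
  mu (R1 a u) (R1 b v) - (S W2 + S1 W1);
  - S1 W2].
have c0 (t : K) : \sum_(i < 4) t ^+ i *: c`_i = 0.
  have := twisted_RB_eq (Rt_RB t) a b u v.
  rewrite /deform /= !bilinear_affine linearDl linearDr linearZl_LR linearZr_LR /=.
  have -> : mu_l (R a u) v + t *: mu_l (R1 a u) v
      + (mu_r u (R b v) + t *: mu_r u (R1 b v))
      + (Phi (R a u) (R b v)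
         + t *: (Phi (R a u) (R1 b v) + Phi (R1 a u) (R b v)) + t ^+ 2 *: W2)
    = W0 + t *: W1 + t ^+ 2 *: W2.
    by rewrite [X in X + _]addrACA -scalerDr addrA addrACA -scalerDr.
  move/eqP; rewrite -subr_eq0 => /eqP Et; rewrite -[RHS]Et.
  (* With the [W]s opaque, linearity separates powers of [t] without splitting the sums inside
     them. *)
  rewrite -/S -/S1 {Et}; clearbody W0 W1 W2.
  rewrite !big_ord_recl big_ord0 /= /bump /= addr0 scale1r expr1.
  rewrite !(linearD, linearZ) /= !(scalerBr, scalerDr, scalerN, opprD, scalerA).
  rewrite -expr2 -exprS !addrA.
  by rewrite [LHS](ACl (1*3*4*7*2*5*8*6*9*10)).
have /= c1 := scaler_poly_coef_eq0 _ _ _ _ charK0 c0 (inord 1).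
rewrite inordK //= in c1; rewrite /delta1 -/W0 -/S -/S1 -[RHS]c1.
(* Only [S W1] is expanded: [delta1] also keeps [S1 W0] whole. *)
rewrite [S W1]linearD [S (_ + mu_r _ _)]linearD [S (Phi _ _ + _)]linearD /=.
by rewrite !opprD !addrA [LHS](ACl (1*5*6*2*3*7*4)).
Qed.
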